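(* Let $\vec\alpha=(\alpha_i)_{i\ge1}$, $\vec\beta=(\beta_i)_{i\ge1}$ be sequences of non-negative reals and $\gamma\ge0$ a real with $\gamma+\sum_i\alpha_i+\sum_i\beta_i=1$. Let $n\ge1$. Then the expected number of fixed points of a permutation in $S_n$ distributed as a $(\vec\alpha,\vec\beta,\gamma)$ shuffle is $$\gamma+\sum_{j=1}^n\Big[\sum_i\big((\alpha_i)^j+(-1)^{j+1}(\beta_i)^j\big)\Big],$$ which is the sum $\sum_{j=1}^n\tilde p_j(\vec\alpha,\vec\beta,\gamma)$ of the first $n$ extended power sum symmetric functions.
   Context: **$(\vec\alpha,\vec\beta,\gamma)$ shuffle.** This is the following probability measure on $S_n$. Choose a word $w_1\cdots w_n$ of integers with independent letters: each letter equals $i>0$ with probability $\alpha_i$, equals $-i<0$ with probability $\beta_i$ ($i\geq 1$), and equals $0$ with probability $\gamma$. Process the distinct letters occurring in the word in increasing order (usual order on $\mathbb Z$), assigning to the positions of each letter the next unused block of consecutive integers from $1,2,\dots,n$ (the block having as many elements as the letter has occurrences). Within the block of a negative letter, the integers are written under its occurrences in decreasing order from left to right. Within the block of a positive letter, they are written in increasing order from left to right. Within the block of the letter $0$, they are written in a uniformly random order (independent of everything else). Then $\pi(k)$ is the integer written under $w_k$. **Extended power sums.** $\tilde p_1(\vec\alpha,\vec\beta,\gamma)=\gamma+\sum_i\alpha_i+\sum_i\beta_i=1$, and for $m\ge2$, $\tilde p_m(\vec\alpha,\vec\beta,\gamma)=\sum_i\alpha_i^m+(-1)^{m+1}\sum_i\beta_i^m$.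 *)

(* Defs.v *)
From HB Require Import structures.
From mathcomp Require Import all_boot all_order all_algebra all_fingroup.
From mathcomp Require Import all_classical all_reals all_analysis.

Set Implicit Arguments.
Unset Strict Implicit.
Unset Printing Implicit Defensive.

Import Order.TTheory GRing.Theory Num.Theory.
Import numFieldNormedType.Exports.

Local Open Scope ring_scope.

(* Sequences are indexed from 0: [alpha i] and [beta i] stand for the
   mathematical alpha_(i+1) and beta_(i+1). Since [Negz i] is the integer
   -(i+1), the letter i+1 has probability [alpha i] and the letter -(i+1) has
   probability [beta i]. *)
Definition letter_prob (R : realType) (alpha beta : nat -> R) (gamma : R)
    (z : int) : R :=
  match z with
  | Posz 0 => gamma
  | Posz i.+1 => alpha i
  | Negz i => beta i
  end.

(* Positions and values both range over 0, ..., n-1 instead of 1, ..., n. The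
   block of the letter a is then the interval of values from the number of
   letters < a (included) to the number of letters <= a (excluded). No
   condition is imposed on the relative order of the values under the letter
   0, so every such order gives an admissible filling. *)
Definition fills (n : nat) (w : {ffun 'I_n -> int}) (s : 'S_n) : bool :=
  [forall k : 'I_n,
    (#|[pred l | (w l < w k)%R]| <= s k < #|[pred l | (w l <= w k)%R]|)%N] &&
  [forall k : 'I_n, forall l : 'I_n,
    ((k < l)%N && (w k == w l)) ==>
      (((0 < w k) ==> (s k < s l)%N) && ((w k < 0) ==> (s l < s k)%N))].

(* Conditional probability of s given the word w: the m letters 0 of w carry
   one of m! equally likely orders, everything else being determined by w. *)
Definition fill_prob (R : realType) (n : nat) (w : {ffun 'I_n -> int})
    (s : 'S_n) : R :=
  if fills w s then (#|[pred k | w k == 0]| `!)%:R^-1 else 0.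

(* Probability of s under the (alpha, beta, gamma) shuffle, summing over all
   the (countably many) words of length n. *)
Definition shuffle_prob (R : realType) (alpha beta : nat -> R) (gamma : R)
    (n : nat) (s : 'S_n) : \bar R :=
  (\esum_(w in [set: {ffun 'I_n -> int}]%classic)
     ((\prod_(k < n) letter_prob alpha beta gamma (w k)) * fill_prob R w s)%:E)%E.

Definition shuffle_distributed (R : realType) (alpha beta : nat -> R)
    (gamma : R) (n : nat) (d : measure_display) (T : measurableType d)
    (P : probability T R) (sigma : T -> 'S_n) : Prop :=
  forall s : 'S_n,
    measurable [set t | sigma t = s]%classic /\
    P [set t | sigma t = s]%classic = shuffle_prob alpha beta gamma s.

Definition fixed_points (n : nat) (s : 'S_n) : nat := #|[pred k | s k == k]|.

(* Only meant for m >= 1. *)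
Definition ext_power_sum (R : realType) (alpha beta : nat -> R) (gamma : R)
    (m : nat) : \bar R :=
  (if m == 1%N then
     gamma%:E + \sum_(0 <= i <oo) (alpha i)%:E + \sum_(0 <= i <oo) (beta i)%:E
   else
     \sum_(0 <= i <oo) (alpha i ^+ m)%:E +
     ((-1) ^+ m.+1)%:E * \sum_(0 <= i <oo) (beta i ^+ m)%:E)%E.

(* Main.v *)
Require Import Defs.
From HB Require Import structures.
From mathcomp Require Import all_boot all_order all_algebra all_fingroup.
From mathcomp Require Import all_classical all_reals all_analysis.
From mathcomp Require Import measurable_realfun.
From mathcomp Require Import ring zify lra.

Set Implicit Arguments.
Unset Strict Implicit.
Unset Printing Implicit Defensive.

Import Order.TTheory GRing.Theory Num.Theory.
Import numFieldNormedType.Exports.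

Local Open Scope ring_scope.

(** Split the expected number of fixed points according to the letter carried
by the fixed position; letter by letter, the contributions are
- [alpha_i + alpha_i^2 + ... + alpha_i^n] for the positive letter [i];
- [beta_i - beta_i^2 + ... + (-1)^(n+1) beta_i^n] for the negative letter [-i];
- [gamma] for the letter 0.

If [w k = a > 0], then [k] is fixed exactly when as many letters [< a] stand to
the right of [k] as letters [> a] stand to its left; for [a < 0] the same holds
with [<=] and [>=]. With [x] and [y] the probabilities of the two events, the
probability of this balance is the coefficient of [X^N] (where [N = n - 1]) in
[(X ((1 - x) + x X))^(N - k) (y + (1 - y) X)^k]. The sum over [k] is the complete
homogeneous polynomial of degree [N] in two linear forms that both differ from
[(1 - x - y) X] by a multiple of [c = y + x X]. Expanding around [(1 - x - y) X]
gives [sum_(j <= N) (1 - x - y)^j], where [1 - x - y] is [alpha_i], respectively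
[- beta_i].

For the letter 0, the block of values depends on the word only through its
letter counts, so by exchangeability the position carrying 0 may be decoupled
from the position compared with the block. *)

(** * Balanced words over a finite alphabet *)

Section CompleteHomogeneous.
Variable A : comNzRingType.
Implicit Types (a b p q r : A) (N : nat).

(** The complete homogeneous symmetric polynomial of degree [N] in two variables, that is (a^(N+1) -
    b^(N+1)) / (a - b) written without division. *)
Definition hsum2 N a b := \sum_(i < N.+1) a ^+ (N - i) * b ^+ i.

Lemma hsum20 a b : hsum2 0 a b = 1.
Proof. by rewrite /hsum2 big_ord1 !expr0 mulr1. Qed.

Lemma hsum2S N a b : hsum2 N.+1 a b = a * hsum2 N a b + b ^+ N.+1.
Proof.
rewrite /hsum2 big_ord_recr/= subnn mul1r mulr_sumr; congr (_ + _).
by apply: eq_bigr => i _; rewrite subSn ?exprS ?mulrA ?leq_ord.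
Qed.

(** Dividing the binomial expansion of (p + q)^(N+1) - (p + r)^(N+1) by q - r gives the formula; the
    induction on [N] avoids the division. *)
Lemma hsum2_shift N p q r :
  hsum2 N (p + q) (p + r) =
  \sum_(m < N.+1) p ^+ (N - m) * hsum2 m q r *+ 'C(N.+1, m.+1).
Proof.
elim: N => [|N IH]; first by rewrite big_ord1 !hsum20 expr0 binn mulr1.
rewrite hsum2S IH.
(* Pascal's rule: the summands with ['C(N.+1, m.+1)] make up p times the sum for [N]; those with
   ['C(N.+1, m)] make up q times that sum plus the expansion of (p + r)^(N+1). *)
under [RHS]eq_bigr do rewrite binS mulrnDr.
rewrite big_split/= [X in _ = X + _]big_ord_recr/= bin_small// mulr0n addr0.
rewrite mulrDl mulr_sumr -addrA; congr (_ + _).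
  by apply: eq_bigr => i _; rewrite subSn ?leq_ord// exprS -mulrA mulrnAr.
rewrite exprDn [X in _ + X = _]big_ord_recl [RHS]big_ord_recl/= !bin0 hsum20 expr0 addrCA.
congr (_ + _).
rewrite mulr_sumr -big_split/=; apply: eq_bigr => i _.
rewrite /bump/= !add1n hsum2S subSS mulrDr mulrnDl.
by rewrite mulrnAr mulrCA.
Qed.

(** The case r = 0, where only the leading term q^m of [hsum2 m q 0] survives. *)
Lemma hsum2_shift0 N p q :
  hsum2 N (p + q) p = \sum_(m < N.+1) p ^+ (N - m) * q ^+ m *+ 'C(N.+1, m.+1).
Proof.
rewrite -{2}[p]addr0 hsum2_shift; apply: eq_bigr => m _.
congr (_ * _ *+ _); rewrite /hsum2 big_ord_recl/= subn0 mulr1 big1 ?addr0//.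
by move=> i _; rewrite /bump/= add1n exprS mul0r mulr0.
Qed.

End CompleteHomogeneous.

Lemma sumr_coef_horner1 (R : comNzRingType) (p : {poly R}) m :
  (size p <= m)%N -> \sum_(i < m) p`_i = p.[1].
Proof.
by move=> sp; rewrite (horner_coef_wide _ sp); apply: eq_bigr => i _; rewrite expr1n mulr1.
Qed.

Lemma coef_hsum2_linear (R : comNzRingType) (x y : R) N :
  (hsum2 N ('X * ((1 - x)%:P + x *: 'X)) (y%:P + (1 - y) *: 'X))`_N =
  \sum_(j < N.+1) (1 - x - y) ^+ j.
Proof.
set a := 1 - x - y; set c := y%:P + x *: 'X.
have -> : 'X * ((1 - x)%:P + x *: 'X) = a%:P * 'X + 'X * c.
  rewrite /a /c -!mul_polyC !polyCB; ring.
have -> : y%:P + (1 - y) *: 'X = a%:P * 'X + c.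
  rewrite /a /c -!mul_polyC !polyCB; ring.
have sc m : (size (c ^+ m) <= m.+1)%N.
  apply: leq_trans (size_poly_exp_leq _ _) _.
  have : (size c <= 2)%N.
    rewrite /c (leq_trans (size_polyD _ _))// geq_max.
    rewrite (leq_trans (size_polyC_leq1 _))//= (leq_trans (size_scale_leq _ _))//.
    by rewrite size_polyX.
  by case: (size c) => [|[|[|]]]//= _; rewrite ?mul0n// mul1n.
have c1 : c.[1] = 1 - a by rewrite /c !hornerE /a; ring.
(* Here [hsum2] is c^m (1 + X + ... + X^m). As c^m has degree at most m, the coefficient of X^m adds
   up all its coefficients, giving c(1)^m. *)
have hc m : (hsum2 m ('X * c) c)`_m = (1 - a) ^+ m.
  rewrite -c1 -horner_exp -(sumr_coef_horner1 (sc m)) coef_sum.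
  apply: eq_bigr => i _; rewrite exprMn -mulrA -exprD subnK ?leq_ord//.
  by rewrite coefXnM ltnNge leq_subr/= subKn ?leq_ord.
rewrite hsum2_shift coef_sum.
(* The geometric sum is [hsum2 N 1 a]; with 1 written as a + (1 - a), it has the same binomial
   expansion as the left side. *)
have -> : \sum_(j < N.+1) a ^+ j = hsum2 N (a + (1 - a)) a.
  rewrite addrC subrK; apply: eq_bigr => i _; by rewrite expr1n mul1r.
rewrite hsum2_shift0; apply: eq_bigr => m _.
rewrite coefMn exprMn -polyC_exp -mulrA coefCM coefXnM.
by rewrite ltnNge leq_subr/= subKn ?leq_ord// hc.
Qed.

Lemma prod_split_ord (A : comNzRingType) N (k : 'I_N.+1) (g b a : A) :
  \prod_(l < N.+1) (if l == k then g else if (l < k)%N then b else a) =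
  g * (a ^+ (N - k) * b ^+ k).
Proof.
rewrite -(big_mkord xpredT
  (fun l : nat => if l == k :> nat then g else if (l < k)%N then b else a)).
rewrite (big_cat_nat (n := k))//= ?(ltnW (ltn_ord k))// (big_ltn (ltn_ord k)) eqxx.
rewrite (eq_big_nat _ _ (F2 := fun=> b)); last first.
  by move=> l /andP[_ lk]; rewrite lk (ltn_eqF lk).
rewrite [X in _ * (_ * X)](eq_big_nat _ _ (F2 := fun=> a)); last first.
  by move=> l /andP[kl _]; rewrite (gtn_eqF kl) ltnNge (ltnW kl).
by rewrite !prodr_const_nat subn0 subSS mulrCA [b ^+ _ * _]mulrC.
Qed.

Section FinCount.
Variables (R : comNzRingType) (F : finType) (q : F -> R).

(** Independence: the coordinates other than [k] sum out to 1. *)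
Lemma sum_prod_ffun n (k : 'I_n) (G : pred F) : \sum_f q f = 1 ->
  \sum_(c : {ffun 'I_n -> F} | G (c k)) \prod_l q (c l) = \sum_(f | G f) q f.
Proof.
move=> q1.
transitivity (\sum_(c : {ffun 'I_n -> F}) \prod_(l < n)
   (if l == k then (G (c l))%:R * q (c l) else q (c l))).
  rewrite big_mkcond; apply: eq_bigr => c _.
  rewrite (bigD1 k)//= [in RHS](bigD1 k)//= eqxx.
  rewrite [X in _ = _ * X](eq_bigr (fun l => q (c l))); last first.
    by move=> l /negPf->.
  by case: (G _); rewrite ?mul1r ?mul0r.
pose W (l : 'I_n) f := if l == k then (G f)%:R * q f else q f.
have -> : \sum_(c : {ffun 'I_n -> F}) \prod_l W l (c l) = \prod_l \sum_f W l f.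
  by rewrite bigA_distr_bigA.
rewrite /W (bigD1 k)//= eqxx [X in _ * X]big1 ?mulr1; last by move=> l /negPf->; exact: q1.
by rewrite [RHS]big_mkcond; apply: eq_bigr => f _; case: (G f); rewrite ?mul1r ?mul0r.
Qed.

(** [G] marks the letter under study, [D] the letters counted to its right and [U] those counted to
    its left. A generating function turns the balance into the extraction of one coefficient;
    independence makes it a product over positions, and summing over [k] produces [hsum2]. *)
Lemma sum_balanced_ffun n (G D U : pred F) : \sum_f q f = 1 ->
  \sum_(k < n) \sum_(c : {ffun 'I_n -> F} | G (c k) &&
      (#|[pred l : 'I_n | (k < l)%N && D (c l)]| ==
       #|[pred l : 'I_n | (l < k)%N && U (c l)]|)) \prod_l q (c l) =
  (\sum_(f | G f) q f) *
  \sum_(j < n) (1 - \sum_(f | D f) q f - \sum_(f | U f) q f) ^+ j.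
Proof.
move=> q1; case: n => [|N]; first by rewrite !big_ord0 mulr0.
rewrite -coef_hsum2_linear -coefCM /hsum2 mulr_sumr coef_sum.
apply: eq_bigr => k _.
(* The exponents add up to [N] exactly when the two counts agree. *)
pose e (l : 'I_N.+1) f : nat :=
  if l == k then 0%N else if (l < k)%N then ~~ U f : nat else (D f).+1.
pose W (l : 'I_N.+1) f : {poly R} := ((if l == k then G f else true)%:R * q f) *: 'X^(e l f).
transitivity ((\sum_(c : {ffun 'I_N.+1 -> F}) \prod_l W l (c l))`_N).
  rewrite coef_sum big_mkcond; apply: eq_bigr => c _.
  rewrite scaler_prod coefZ big_split/= prodrXr coefXn.
  have -> : \prod_(l < N.+1) ((if l == k then G (c l) else true)%:R : R) = (G (c k))%:R.
    rewrite (bigD1 k)//= eqxx big1 ?mulr1// => l /negPf -> //.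
  suff -> : (N == \sum_(l < N.+1) e l (c l)) =
      (#|[pred l : 'I_N.+1 | (k < l)%N && D (c l)]| ==
       #|[pred l : 'I_N.+1 | (l < k)%N && U (c l)]|).
    by case: (G _); case: eqP; rewrite /= ?mul0r ?mul1r ?mulr1 ?mulr0.
  (* Each position other than [k] contributes 1 to the exponent, less 1 for a letter of [U] on the
     left, plus 1 for a letter of [D] on the right. *)
  have E : (\sum_(l < N.+1) e l (c l) + #|[pred l : 'I_N.+1 | (l < k)%N && U (c l)]|
     = N + #|[pred l : 'I_N.+1 | (k < l)%N && D (c l)]|)%N.
    have NE : N = (\sum_(l < N.+1) (l != k))%N.
      transitivity (\sum_(l < N.+1 | l != k) 1)%N.
        by rewrite sum1_card cardC1 card_ord.
      by rewrite big_mkcond; apply: eq_bigr => l _; case: eqP.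
    rewrite [X in _ = (X + _)%N]NE -!sum1_card.
    rewrite [X in (_ + X = _)%N]big_mkcond [X in (_ = _ + X)%N]big_mkcond -!big_split/=.
    apply: eq_bigr => l _; rewrite /e !inE -val_eqE/=.
    by case: ltngtP; case: (U _); case: (D _).
  by rewrite -(eqn_add2r #|[pred l : 'I_N.+1 | (l < k)%N && U (c l)]|) E eqn_add2l eq_sym.
have -> : \sum_(c : {ffun 'I_N.+1 -> F}) \prod_l W l (c l) = \prod_l \sum_f W l f.
  by rewrite bigA_distr_bigA.
rewrite -prod_split_ord; congr (nth 0 (polyseq _) N).
apply: eq_bigr => l _; rewrite /W /e; case: eqP => _.
  rewrite raddf_sum/= [RHS]big_mkcond; apply: eq_bigr => f _.
  by case: (G f); rewrite ?mul1r ?mul0r ?scale0r// alg_polyC.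
(* Total mass 1 makes the generating polynomial of an indicator a linear form. It is applied to the
   complement of [U] on the left and, up to a factor X, to [D] on the right. *)
have split (V : pred F) : \sum_f q f *: 'X^(V f) =
    (1 - \sum_(f | V f) q f)%:P + (\sum_(f | V f) q f) *: 'X :> {poly R}.
  rewrite -q1 (bigID V)/= addrC; congr (_ + _).
    rewrite [X in (X - _)%:P](bigID V)/= addrAC subrr add0r raddf_sum/=.
    by apply: eq_bigr => f /negPf->; rewrite alg_polyC.
  by rewrite scaler_suml; apply: eq_bigr => f ->.
case: ifP => _.
  rewrite (eq_bigr (fun f => q f *: 'X^(predC U f))) => [|f _]; last by rewrite mul1r.
  rewrite split; congr (_%:P + _ *: _).
    by rewrite -q1 (bigID U)/= addrK.
  by rewrite -q1 [X in _ = X - _](bigID U)/= addrAC subrr add0r.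
rewrite -split mulr_sumr; apply: eq_bigr => f _.
by rewrite mul1r exprS scalerAr.
Qed.

End FinCount.

(** * Exchangeability and the block of the letter 0 *)

Section BlockCount.
Variables (R : numFieldType) (F : finType) (q : F -> R) (n : nat).
Implicit Types (c : {ffun 'I_n -> F}) (s : 'S_n).

Lemma card_ffun_perm (V : pred F) c s :
  #|[pred l | V ([ffun l => c (s l)] l)]| = #|[pred l | V (c l)]|.
Proof.
rewrite -cardsE -[RHS]cardsE -[RHS](card_preimset _ (@perm_inj _ s)).
by apply: eq_card => l; rewrite !inE ffunE.
Qed.

(** Let [S k k0] be the sum in which [k] carries a letter of [Z] and [k0] is compared with the
    block. By exchangeability it does not depend on [k], so n times the diagonal sum is the full
    double sum. There m positions meet a block of m values of weight 1/m, leaving m, whose mean is n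
    times the mass of [Z]. *)
Lemma sum_block_ffun (Z L : pred F) : (0 < n)%N -> \sum_f q f = 1 ->
  (forall f, L f -> ~~ Z f) ->
  \sum_(k < n) \sum_(c : {ffun 'I_n -> F} | Z (c k)) (\prod_l q (c l)) *
     (if (#|[pred l | L (c l)]| <= k < #|[pred l | L (c l)]| + #|[pred l | Z (c l)]|)%N
      then (#|[pred l | Z (c l)]|)%:R^-1 else 0) =
  \sum_(f | Z f) q f.
Proof.
move=> n_gt0 q1 LZ.
pose g c k : R := if (#|[pred l | L (c l)]| <= k < #|[pred l | L (c l)]| + #|[pred l | Z (c l)]|)%N
  then (#|[pred l | Z (c l)]|)%:R^-1 else 0.
have g_perm c s k : g [ffun l => c (s l)] k = g c k.
  by rewrite /g !card_ffun_perm.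
pose S (k k0 : 'I_n) := \sum_(c : {ffun 'I_n -> F} | Z (c k)) (\prod_l q (c l)) * g c k0.
have S_const k k' k0 : S k k0 = S k' k0.
  pose s := tperm k k'.
  rewrite /S (reindex_inj (h := fun c => [ffun l => c (s l)])) /=; last first.
    by move=> c c' /ffunP cc'; apply/ffunP => l; have := cc' (s l); rewrite !ffunE tpermK.
  apply: eq_big => [c|c _]; first by rewrite ffunE tpermL.
  rewrite g_perm; congr (_ * _); rewrite [RHS](reindex_inj (@perm_inj _ s))/=.
  by apply: eq_bigr => l _; rewrite ffunE.
(* Disjointness of [L] and [Z] keeps the block inside [0, n), so it holds exactly m positions. The
   factor m on both sides covers the case m = 0. *)
have sum_g c : #|[pred l | Z (c l)]|%:R * \sum_(k < n) g c k = #|[pred l | Z (c l)]|%:R.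
  set a := #|[pred l | L (c l)]|; set m := #|[pred l | Z (c l)]|.
  have amn : (a + m <= n)%N.
    rewrite -cardUI [X in (_ + X)%N]eq_card0 ?addn0 => [|l]; last first.
      by rewrite !inE; apply/negP => /andP[/LZ/negP].
    by rewrite (leq_trans (max_card _))// card_ord.
  have [->|m_neq0] := eqVneq m 0%N; first by rewrite !mul0r.
  rewrite -(big_mkord xpredT (g c)) (big_cat_nat (n := a))//=; last first.
    exact: leq_trans (leq_addr _ _) amn.
  rewrite (big_cat_nat (n := a + m) (m := a))//= ?leq_addr//.
  rewrite big_nat big1 => [|k /andP[_ ka]]; last by rewrite /g -/a leqNgt ka.
  rewrite [X in _ + (_ + X)]big_nat [X in _ + (_ + X)]big1 => [|k /andP[amk _]].
    rewrite (eq_big_nat _ _ (F2 := fun=> m%:R^-1)) => [|k ka].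
      rewrite sumr_const_nat addKn add0r addr0 -(mulr_natl m%:R^-1) divff ?mulr1//.
      by rewrite pnatr_eq0.
    by rewrite /g -/a -/m ka.
  by rewrite /g -/a -/m (ltnNge k) amk andbF.
apply: (@mulfI _ n%:R); first by rewrite pnatr_eq0 -lt0n.
transitivity (\sum_(k0 < n) \sum_(k < n) S k k0).
  rewrite mulr_sumr; apply: eq_bigr => k0 _.
  rewrite [RHS](eq_bigr (fun=> S k0 k0)) => [|k _]; last exact: S_const.
  by rewrite sumr_const card_ord mulr_natl.
transitivity (\sum_(k < n) \sum_(c : {ffun 'I_n -> F} | Z (c k)) \prod_l q (c l)).
  rewrite exchange_big/= /S.
  under eq_bigr do rewrite exchange_big/=.
  rewrite (exchange_big_dep xpredT)//= [RHS](exchange_big_dep xpredT)//=.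
  apply: eq_bigr => c _.
  under eq_bigr do rewrite -mulr_sumr.
  rewrite !sumr_const -mulr_natl mulrCA sum_g mulrC mulr_natl; congr (_ *+ _).
rewrite (eq_bigr (fun=> \sum_(f | Z f) q f)) => [|k _]; last exact: sum_prod_ffun.
by rewrite sumr_const card_ord mulr_natl.
Qed.

End BlockCount.

(** * Permutations filling a given word *)

Lemma card_ord_lt n m : (m <= n)%N -> #|[pred l : 'I_n | (l < m)%N]| = m.
Proof.
move=> mn; rewrite -sum1_card -(big_mkord (fun l => (l < m)%N) (fun=> 1%N)).
by rewrite -(big_nat_widen _ _ _ xpredT)// sum_nat_const_nat subn0 muln1.
Qed.

Lemma perm_rank n (s : 'S_n) k : #|[pred l | (s l < s k)%N]| = s k.
Proof.
rewrite -[RHS](card_ord_lt (ltnW (ltn_ord (s k)))).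
rewrite -cardsE -[RHS]cardsE -[RHS](card_preimset _ (@perm_inj _ s)).
by apply: eq_card => l; rewrite !inE.
Qed.

Section Words.
Variables (n : nat) (w : {ffun 'I_n -> int}).
Implicit Types (k l : 'I_n) (s t : 'S_n).

Lemma card_le_lt k l : w k < w l ->
  (#|[pred i | (w i <= w k)%R]| <= #|[pred i | (w i < w l)%R]|)%N.
Proof.
move=> kl; apply/subset_leq_card/fintype.subsetP => i; rewrite !inE.
by move=> /le_lt_trans; apply.
Qed.

Lemma fillsP s : reflect
  ((forall k, (#|[pred l | (w l < w k)%R]| <= s k < #|[pred l | (w l <= w k)%R]|)%N) /\
   (forall k l, (k < l)%N -> w k = w l ->
      (0 < w k -> (s k < s l)%N) /\ (w k < 0 -> (s l < s k)%N)))
  (fills w s).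
Proof.
apply: (iffP andP) => -[/forallP fb fo]; split=> //.
- move=> k l kl wkl; move: (fo) => /'forall_forallP/(_ k l).
  by rewrite kl wkl eqxx => /andP[/implyP ? /implyP].
- by apply/'forall_forallP => k l; apply/implyP => /andP[kl /eqP wkl];
    have [? ?] := fo k l kl wkl; apply/andP; split; apply/implyP.
Qed.

Lemma fills_lt s k l : fills w s -> w k < w l -> (s k < s l)%N.
Proof.
move=> /fillsP[fb _] kl; have /andP[_ h1] := fb k; have /andP[h2 _] := fb l.
by rewrite (leq_trans h1)// (leq_trans (card_le_lt kl)).
Qed.

(** By [perm_rank], [s k] counts the smaller values; by [fills_lt], every smaller letter contributes
    and no larger one does. *)
Lemma fills_rank s k : fills w s ->
  s k = (#|[pred l | (w l < w k)%R]| +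
         #|[pred l | (w l == w k) && (s l < s k)%N]|)%N :> nat.
Proof.
move=> fs; rewrite -[LHS]perm_rank -!sum1_card big_mkcond.
rewrite [X in (X + _)%N]big_mkcond [X in (_ + X)%N]big_mkcond -big_split/=.
apply: eq_bigr => l _; rewrite !inE.
case: ltgtP => [/(fills_lt fs)->|/(fills_lt fs)/ltnW|]//=.
by rewrite leqNgt => /negPf->.
Qed.

Lemma fills_rank_pos s k : fills w s -> 0 < w k ->
  s k = (#|[pred l | (w l < w k)%R]| + #|[pred l | (w l == w k) && (l < k)%N]|)%N :> nat.
Proof.
move=> fs k0; rewrite (fills_rank k fs); congr (_ + _)%N; apply: eq_card => l.
rewrite !inE; case: eqP => //= wlk; have /fillsP[_ fo] := fs.
case: (ltngtP l k) => [lk|kl|/val_inj->]; last by rewrite ltnn.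
- by have [-> //] := fo _ _ lk wlk; rewrite wlk.
- by have [/(_ k0) h _] := fo _ _ kl (esym wlk); rewrite ltnNge (ltnW h).
Qed.

Lemma fills_rank_neg s k : fills w s -> w k < 0 ->
  s k = (#|[pred l | (w l < w k)%R]| + #|[pred l | (w l == w k) && (k < l)%N]|)%N :> nat.
Proof.
move=> fs k0; rewrite (fills_rank k fs); congr (_ + _)%N; apply: eq_card => l.
rewrite !inE; case: eqP => //= wlk; have /fillsP[_ fo] := fs.
case: (ltngtP k l) => [kl|lk|/val_inj->]; last by rewrite ltnn.
- by have [_ -> //] := fo _ _ kl (esym wlk).
- by have [_] := fo _ _ lk wlk; rewrite wlk => /(_ k0) h; rewrite ltnNge (ltnW h).
Qed.

(* The order in which positions receive the values; the tie-break among the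
   zeros is an arbitrary choice. *)
Definition prec k l := (w k < w l) ||
  ((w k == w l) && (if w l < 0 then (l < k)%N else (k < l)%N)).

Lemma prec_irr k : prec k k = false.
Proof. by rewrite /prec ltxx eqxx ltnn; case: ifP. Qed.

Lemma prec_trans : transitive prec.
Proof.
move=> l k m /orP[kl|/andP[/eqP kl ol]] /orP[lm|/andP[/eqP lm om]]; rewrite /prec.
- by rewrite (lt_trans kl lm).
- by rewrite -lm kl.
- by rewrite kl lm.
- move: ol om; rewrite kl lm ltxx eqxx/=; case: ifP => _ h1 h2.
    exact: ltn_trans h2 h1.
  exact: ltn_trans h1 h2.
Qed.

Lemma prec_total k l : k != l -> prec k l || prec l k.
Proof.
rewrite -val_eqE/= neq_ltn /prec; case: (ltgtP (w k) (w l)) => //= ->.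
by case: ifP => //; rewrite orbC.
Qed.

Definition prec_card k := #|[pred l | prec l k]|.

Lemma prec_card_lt k l : prec k l -> (prec_card k < prec_card l)%N.
Proof.
move=> kl; apply: proper_card; apply/properP; split.
  by apply/fintype.subsetP => i; rewrite !inE => /prec_trans; apply.
by exists k; rewrite !inE ?prec_irr.
Qed.

Lemma prec_card_ltn k : (prec_card k < n)%N.
Proof.
rewrite -[X in (_ < X)%N]card_ord; apply: proper_card; apply/properP; split.
  by apply/fintype.subsetP.
by exists k; rewrite !inE ?prec_irr.
Qed.

Lemma prec_ord_inj : injective (fun k => Ordinal (prec_card_ltn k)).
Proof.
move=> k l [] eq_kl; apply/eqP/negPn/negP => /prec_total/orP[]/prec_card_lt;
by rewrite eq_kl ltnn.
Qed.

(** The witness gives each position its rank for the strict total order [prec]. *)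
Lemma fills_exists : exists s, fills w s.
Proof.
exists (perm prec_ord_inj); apply/fillsP; split=> [k|k l kl wkl]; rewrite !permE/=.
  apply/andP; split.
    by apply/subset_leq_card/fintype.subsetP => l; rewrite !inE /prec => ->.
  apply: proper_card; apply/properP; split.
    apply/fintype.subsetP => l; rewrite !inE /prec le_eqVlt.
    by move=> /orP[->|/andP[->]]//; rewrite orbT.
  by exists k; rewrite !inE ?prec_irr.
split=> wk; apply: prec_card_lt; rewrite /prec wkl eqxx ltxx/=.
  by rewrite -wkl ltNge ltW.
by rewrite -wkl wk.
Qed.

Definition zeros : {set 'I_n} := [set k | w k == 0]%SET.

Lemma perm_on_word t k : perm_on zeros t -> w (t k) = w k.
Proof.
move=> tZ; have [kZ|kZ] := boolP (k \in zeros); last by rewrite (out_perm tZ).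
have := perm_closed k tZ; rewrite kZ => tkZ; move: kZ tkZ.
by rewrite !inE => /eqP-> /eqP->.
Qed.

(** In the product [t] acts first. It preserves letters, hence the block condition, and the order
    conditions concern only positions that it fixes. *)
Lemma fills_perm_on s t : perm_on zeros t -> fills w s -> fills w (t * s)%g.
Proof.
move=> tZ /fillsP[fb fo]; apply/fillsP; split=> [k|k l kl wkl]; rewrite !permM.
  by have := fb (t k); rewrite perm_on_word.
have out i : w i != 0 -> t i = i by move=> wi; rewrite (out_perm tZ)// inE.
split=> wk.
  have wk0 := gt_eqF wk; rewrite !out -?wkl ?wk0//.
  by have [->] := fo _ _ kl wkl.
have wk0 := lt_eqF wk; rewrite !out -?wkl ?wk0//.
by have [_ ->] := fo _ _ kl wkl.
Qed.

Lemma fills_out s t k : fills w s -> fills w t -> w k != 0 -> s k = t k.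
Proof.
move=> fs ft; rewrite neq_lt => /orP[] wk; apply: val_inj => /=.
  by rewrite (fills_rank_neg fs wk) (fills_rank_neg ft wk).
by rewrite (fills_rank_pos fs wk) (fills_rank_pos ft wk).
Qed.

(** The fillings form one coset of the group of permutations supported on [zeros]: two fillings
    agree at nonzero letters, so their quotient is supported there. *)
Lemma card_fills : #|[pred s | fills w s]| = #|[pred k | w k == 0]| `!.
Proof.
have [s0 fs0] := fills_exists.
have <- : #|zeros| = #|[pred k | w k == 0]| by apply: eq_card => k; rewrite !inE.
rewrite -card_perm -[RHS](card_imset _ (mulIg s0)); apply: eq_card => s.
rewrite inE; apply/idP/imsetP => [fs|[t tZ ->]]; last exact: fills_perm_on.
exists (s * s0^-1)%g; last by rewrite mulgKV.
apply/fintype.subsetP => k; rewrite inE; apply: contraR; rewrite inE => wk.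
by rewrite permM (fills_out fs fs0 wk) permK.
Qed.

End Words.

(** * Conditional probability of a fixed point given the word *)

Section FixProbability.
Variables (R : realType) (n : nat) (w : {ffun 'I_n -> int}).
Implicit Types (k l : 'I_n) (s t : 'S_n).

Lemma sum_fill_prob : \sum_s fill_prob R w s = 1.
Proof.
rewrite -big_mkcond/= sumr_const.
have -> : #|fills w| = #|[pred k | w k == 0]| `!.
  exact: card_fills.
by rewrite -(mulr_natl _^-1) divff// pnatr_eq0 -lt0n fact_gt0.
Qed.

Lemma card_split3 (P : pred 'I_n) k :
  #|[pred l | P l]| = (#|[pred l : 'I_n | (l < k)%N && P l]| +
    P k + #|[pred l : 'I_n | (k < l)%N && P l]|)%N.
Proof.
have -> : P k = (\sum_(l | (l == k) && P l) 1)%N :> nat.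
  by rewrite big_mkcondr big_pred1_eq; case: (P k).
rewrite -!sum1_card big_mkcond [X in (X + _ + _)%N]big_mkcond.
rewrite [X in (_ + X + _)%N]big_mkcond [X in (_ + X)%N]big_mkcond -!big_split/=.
apply: eq_bigr => l _; rewrite !inE -val_eqE/=.
by case: ltngtP; case: (P l).
Qed.

Definition fix_prob k : R := \sum_(s : 'S_n | s k == k) fill_prob R w s.

Lemma fix_prob_det k (b : bool) :
  (forall s, fills w s -> (s k == k) = b) -> fix_prob k = b%:R.
Proof.
move=> fb; rewrite /fix_prob big_mkcond.
transitivity (\sum_s b%:R * fill_prob R w s); last by rewrite -mulr_sumr sum_fill_prob mulr1.
apply: eq_bigr => s _; have [fs|nfs] := boolP (fills w s).
  by rewrite (fb _ fs); case: b {fb}; rewrite ?mul1r ?mul0r.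
by rewrite /fill_prob (negPf nfs) mulr0 if_same.
Qed.

(** In s k = k, replace the position [k] by the number of positions to its left, sorted by letter:
    the smaller and equal letters on the left cancel. *)
Lemma fix_prob_pos k : 0 < w k ->
  fix_prob k = (#|[pred l : 'I_n | (k < l)%N && (w l < w k)%R]| ==
                #|[pred l : 'I_n | (l < k)%N && (w k < w l)%R]|)%:R.
Proof.
move=> wk; apply: fix_prob_det => s fs; rewrite -val_eqE/= (fills_rank_pos fs wk).
rewrite (card_split3 (fun l => w l < w k) k) ltxx addn0.
have E : (#|[pred l : 'I_n | (l < k)%N && (w l < w k)%R]| +
   #|[pred l | (w l == w k) && (l < k)%N]| +
   #|[pred l : 'I_n | (l < k)%N && (w k < w l)%R]|)%N = k.
  rewrite -[RHS](card_ord_lt (ltnW (ltn_ord k))) -!sum1_card.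
  rewrite big_mkcond [X in (_ + X + _)%N]big_mkcond [X in (_ + X)%N]big_mkcond.
  rewrite [RHS]big_mkcond -!big_split/=; apply: eq_bigr => l _; rewrite !inE.
  by case: (ltgtP (w l) (w k)); case: (l < k)%N.
rewrite -[X in _ == X]E; apply/eqP/eqP; lia.
Qed.

(** Same cancellation, but the equal letters counted in [s k] are now those on the right, so they
    join the smaller letters there while the equal ones on the left stay with the larger. *)
Lemma fix_prob_neg k : w k < 0 ->
  fix_prob k = (#|[pred l : 'I_n | (k < l)%N && (w l <= w k)%R]| ==
                #|[pred l : 'I_n | (l < k)%N && (w k <= w l)%R]|)%:R.
Proof.
move=> wk; apply: fix_prob_det => s fs; rewrite -val_eqE/= (fills_rank_neg fs wk).
rewrite (card_split3 (fun l => w l < w k) k) ltxx addn0.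
have E : (#|[pred l : 'I_n | (l < k)%N && (w l < w k)%R]| +
   #|[pred l : 'I_n | (l < k)%N && (w k <= w l)%R]|)%N = k.
  rewrite -[RHS](card_ord_lt (ltnW (ltn_ord k))) -!sum1_card.
  rewrite big_mkcond [X in (_ + X)%N]big_mkcond.
  rewrite [RHS]big_mkcond -!big_split/=; apply: eq_bigr => l _; rewrite !inE.
  by case: (ltgtP (w l) (w k)); case: (l < k)%N.
have E' : (#|[pred l : 'I_n | (k < l)%N && (w l < w k)%R]| +
   #|[pred l | (w l == w k) && (k < l)%N]|)%N =
   #|[pred l : 'I_n | (k < l)%N && (w l <= w k)%R]|.
  rewrite -!sum1_card.
  rewrite big_mkcond [X in (_ + X)%N]big_mkcond.
  rewrite [RHS]big_mkcond -!big_split/=; apply: eq_bigr => l _; rewrite !inE.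
  by case: (ltgtP (w l) (w k)); case: (k < l)%N.
rewrite -[X in _ == X]E -E'; apply/eqP/eqP; lia.
Qed.

(** A position outside the block of 0 is fixed by no filling. Inside it, exchanging two zeros
    permutes the fillings, so each of the m zeros is equally likely to receive the value [k]. *)
Lemma fix_prob_zero k : w k = 0 ->
  fix_prob k =
    if (#|[pred l | (w l < 0)%R]| <= k <
        #|[pred l | (w l < 0)%R]| + #|[pred l | w l == 0]|)%N
    then (#|[pred l | w l == 0]|)%:R^-1 else 0.
Proof.
move=> wk0; set a := #|_|; set m := #|_|.
have le0 : #|[pred l | (w l <= 0)%R]| = (a + m)%N.
  rewrite /a /m -!sum1_card big_mkcond [X in (X + _)%N]big_mkcond [X in (_ + X)%N]big_mkcond.
  by rewrite -big_split/=; apply: eq_bigr => l _; rewrite !inE; case: ltgtP.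
have blk s : fills w s -> (a <= s k < a + m)%N.
  by move=> /fillsP[/(_ k)]; rewrite wk0 le0.
case: ifP => [ak|ak]; last first.
  rewrite /fix_prob big1// => s /eqP sk; rewrite /fill_prob; case: ifP => // /blk.
  by rewrite sk ak.
pose N l := \sum_(s : 'S_n | s l == k) fill_prob R w s.
have N_const l : w l = 0 -> N l = N k.
  move=> wl; rewrite /N (reindex_inj (mulgI (tperm k l))).
  apply: eq_big => [s|s _]; first by rewrite permM tpermR.
  have tZ : perm_on (zeros w) (tperm k l).
    apply/fintype.subsetP => i; rewrite !inE; case: tpermP => [-> _|-> _|//]; first by rewrite wk0.
      by rewrite wl.
    by rewrite eqxx.
  rewrite /fill_prob; congr (if _ then _ else _).
  apply/idP/idP => [|fs]; last exact: fills_perm_on.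
  by move=> /(fills_perm_on tZ); rewrite mulgA tperm2 mul1g.
have m0 : m%:R != 0 :> R.
  by rewrite pnatr_eq0 -lt0n; apply/card_gt0P; exists k; rewrite inE wk0.
apply: (mulfI m0); rewrite divff// mulr_natl.
transitivity (\sum_(l | w l == 0) N l).
  rewrite (eq_bigr (fun=> N k)) => [|l /eqP]; last exact: N_const.
  by rewrite sumr_const.
(* In each filling only the position [s^-1 k] receives the value [k], and it carries 0 because [k]
   lies in the block of 0. Hence the [N l] add up to 1. *)
rewrite /N (exchange_big_dep xpredT)//= -[RHS]sum_fill_prob; apply: eq_bigr => s _.
have [fs|nfs] := boolP (fills w s); last first.
  by rewrite /fill_prob (negPf nfs) big1.
rewrite (big_pred1 (s^-1 k)%g)// => l /=.
apply/andP/eqP => [[_ /eqP <-]|->]; first by rewrite permK.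
set i := (s^-1 k)%g; have si : s i = k by rewrite permKV.
split; last by rewrite si.
have /fillsP[/(_ i) + _] := fs; rewrite si => /andP[ik ki].
case/andP: ak => ak kam; case: (ltgtP (w i) 0) => // wi.
  have := @card_le_lt _ w i k; rewrite wk0 => /(_ wi) h.
  by have := leq_trans ki (leq_trans h ak); rewrite ltnn.
have := @card_le_lt _ w k i; rewrite wk0 => /(_ wi); rewrite le0 => h.
by have := leq_trans kam (leq_trans h ik); rewrite ltnn.
Qed.

End FixProbability.

(** * Sums over words with independent letters *)

Section Esum.
Variable R : realType.
Local Open Scope ereal_scope.

Lemma esumZl (T : choiceType) (I : set T) (a : T -> \bar R) (r : R) :
  (0 <= r)%R -> (forall i, 0 <= a i) ->
  \esum_(i in I) (r%:E * a i) = r%:E * \esum_(i in I) a i.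
Proof.
move=> r0 a0; rewrite /esum -ereal_supZl//; last first.
  by apply/set0P; exists (\sum_(i \in set0) a i); exists set0 => //; exact: fsets_set0.
congr ereal_sup; apply/seteqP; split=> _ /= [A fA <-].
  exists (\sum_(i \in A) a i); first by exists A.
  by rewrite ge0_mule_fsumr.
by case: fA => B fB <-; exists B => //; rewrite ge0_mule_fsumr.
Qed.

Lemma esum_pair (S T : choiceType) (a : S -> T -> \bar R) :
  (forall i j, 0 <= a i j) ->
  \esum_(i in [set: S]) \esum_(j in [set: T]) a i j =
  \esum_(k in [set: S * T]) a k.1 k.2.
Proof.
move=> a0; rewrite esum_esum//; congr esum.
by apply/seteqP; split.
Qed.

Lemma exchange_esum (S T : choiceType) (a : S -> T -> \bar R) :
  (forall i j, 0 <= a i j) ->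
  \esum_(i in [set: S]) \esum_(j in [set: T]) a i j =
  \esum_(j in [set: T]) \esum_(i in [set: S]) a i j.
Proof.
move=> a0; rewrite !esum_pair//.
rewrite (@reindex_esum _ _ _ [set: T * S] setT (fun x => (x.2, x.1)))//.
split=> //.
- by move=> [x1 x2] [y1 y2] _ _ /= [-> ->].
- by move=> [x1 x2] _; exists (x2, x1).
Qed.

Lemma esum_single (T : choiceType) (x : T) (a : T -> \bar R) :
  0 <= a x -> (forall y, y != x -> a y = 0) -> \esum_(y in [set: T]) a y = a x.
Proof.
move=> ax0 ay0; rewrite -(esum_set1 (t := x)) // [RHS]esum_mkcond.
apply: eq_esum => y _; case: ifPn => //; rewrite notin_setE/= => yx.
by apply: ay0; apply/eqP.
Qed.

(** Tonelli by induction on [n]: the bijection [e] below prepends a first letter to a word. *)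
Lemma esum_ffun_prod (T : choiceType) n (g : 'I_n -> T -> R) (m : 'I_n -> R) :
  (forall k z, (0 <= g k z)%R) ->
  (forall k, \esum_(z in [set: T]) (g k z)%:E = (m k)%:E) ->
  \esum_(w in [set: {ffun 'I_n -> T}]) (\prod_(k < n) g k (w k))%:E =
  (\prod_(k < n) m k)%:E.
Proof.
elim: n => [|n IH] in g m * => g0 gm.
  have [w0 w0E] : exists w0 : {ffun 'I_0 -> T}, forall w, w = w0.
    have f : 'I_0 -> T by case.
    by exists [ffun k => f k] => w; apply/ffunP => -[].
  rewrite (esum_single (x := w0)) ?big_ord0//.
  by move=> w; rewrite (w0E w) eqxx.
pose e (x : T * {ffun 'I_n -> T}) : {ffun 'I_n.+1 -> T} :=
  [ffun k => if unlift ord0 k is Some j then x.2 j else x.1].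
rewrite (@reindex_esum _ _ _ [set: T * {ffun 'I_n -> T}] setT e); last first.
  split=> //.
  - move=> [z w] [z' w'] _ _ /ffunP E; congr pair.
      by have := E ord0; rewrite !ffunE unlift_none.
    by apply/ffunP => j; have := E (lift ord0 j); rewrite !ffunE liftK.
  - move=> w _; exists (w ord0, [ffun j => w (lift ord0 j)]) => //.
    by apply/ffunP => k; rewrite ffunE; case: unliftP => [j|] -> //=; rewrite ffunE.
rewrite big_ord_recl EFinM -gm.
transitivity (\esum_(z in [set: T]) \esum_(w in [set: {ffun 'I_n -> T}])
   ((g ord0 z)%:E * (\prod_(k < n) g (lift ord0 k) (w k))%:E)).
  rewrite esum_pair => [|z w]; last by rewrite -EFinM lee_fin mulr_ge0// prodr_ge0.
  apply: eq_esum => -[z w] _; rewrite big_ord_recl EFinM /e !ffunE unlift_none.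
  by congr (_ * _%:E); apply: eq_bigr => j _; rewrite ffunE liftK.
have IH' := IH (fun k => g (lift ord0 k)) (fun k => m (lift ord0 k)).
have m0 k : (0 <= m k)%R by rewrite -lee_fin -gm esum_ge0// => z _; rewrite lee_fin.
rewrite muleC -esumZl; [|exact: prodr_ge0|by move=> z; rewrite lee_fin].
apply: eq_esum => z _; rewrite esumZl// => [|w]; last by rewrite lee_fin prodr_ge0.
by rewrite IH'// muleC.
Qed.

(* Only the finitely many types h z of the letters matter, so the infinite sum
   over words becomes a finite sum over words in the types. *)
Lemma esum_ffun_types (T : choiceType) (F : finType) (p : T -> R) (h : T -> F)
    (q : F -> R) n (Phi : {ffun 'I_n -> F} -> R) :
  (forall z, (0 <= p z)%R) -> (forall c, (0 <= Phi c)%R) ->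
  (forall f, \esum_(z in [set: T]) (p z * (h z == f)%:R)%:E = (q f)%:E) ->
  \esum_(w in [set: {ffun 'I_n -> T}])
     ((\prod_(k < n) p (w k)) * Phi [ffun k => h (w k)])%:E =
  (\sum_(c : {ffun 'I_n -> F}) (\prod_(k < n) q (c k)) * Phi c)%:E.
Proof.
move=> p0 Phi0 qE.
(* The product of indicators vanishes unless [c] is the word of types of [w]; for fixed [c] the
   summand factors over positions. *)
transitivity (\esum_(w in [set: {ffun 'I_n -> T}]) \sum_(c : {ffun 'I_n -> F})
    ((Phi c)%:E * (\prod_(k < n) (p (w k) * (h (w k) == c k)%:R))%:E)).
  apply: eq_esum => w _; rewrite (bigD1 [ffun k => h (w k)])//= [X in _ + X]big1 ?adde0.
    rewrite mulrC EFinM; congr (_ * EFin _); apply: eq_bigr => k _.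
    by rewrite ffunE eqxx mulr1.
  move=> c; rewrite eq_sym => /eqP cw; suff [k hk] : exists k, h (w k) != c k.
    by rewrite (bigD1 k)//= (negPf hk) mulr0 mul0r mule0.
  apply/not_existsP => H; apply: cw; apply/ffunP => k; rewrite ffunE.
  by apply/eqP/negPn/negP; exact: H.
have pr0 w (c : {ffun 'I_n -> F}) : (0 <= \prod_(k < n) (p (w k) * (h (w k) == c k)%:R))%R.
  by apply: prodr_ge0 => k _; rewrite mulr_ge0.
rewrite esum_sum; last by move=> w c _ _; rewrite -EFinM lee_fin mulr_ge0.
rewrite -sumEFin; apply: eq_bigr => c _.
rewrite esumZl//; last by move=> w; rewrite lee_fin.
rewrite (esum_ffun_prod (g := fun k z => (p z * (h z == c k)%:R)%R)
  (m := fun k => q (c k))) => [|k z|k].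
- by rewrite -EFinM mulrC.
- by rewrite mulr_ge0.
- exact: qE.
Qed.

Lemma esum_type_pred (T : choiceType) (F : finType) (p : T -> R) (h : T -> F)
    (q : F -> R) (S : pred F) :
  (forall z, (0 <= p z)%R) ->
  (forall f, \esum_(z in [set: T]) (p z * (h z == f)%:R)%:E = (q f)%:E) ->
  \esum_(z in [set: T]) (p z * (S (h z))%:R)%:E = (\sum_(f | S f) q f)%:E.
Proof.
move=> p0 qE; rewrite -sumEFin.
under eq_bigr do rewrite -qE.
rewrite -esum_sum => [|z f _ _]; last by rewrite lee_fin mulr_ge0.
apply: eq_esum => z _; rewrite sumEFin -mulr_sumr; congr ((_ * _)%R%:E).
rewrite big_mkcond (bigD1 (h z))//= eqxx big1 ?addr0; first by case: (S _).
by move=> f; rewrite eq_sym => /negPf->; rewrite if_same.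
Qed.

Lemma esum_int (f : int -> \bar R) : (forall z, 0 <= f z) ->
  \esum_(z in [set: int]) f z =
  f 0%R + \sum_(0 <= i <oo) f (Posz i.+1) + \sum_(0 <= i <oo) f (Negz i).
Proof.
move=> f0; rewrite (esumID (range Negz))// !setTI addeC; congr (_ + _); last first.
  by rewrite esum_image => [|x y _ _ []//]; rewrite nneseries_esumT.
have -> : (~` range Negz)%classic = range Posz.
  apply/seteqP; split=> [[m|m]|_ [m _ <-] []//] H; first by exists m.
  by exfalso; apply: H; exists m.
rewrite esum_image => [|x y _ _ []//]; rewrite -(@nneseries_esumT _ (fun i => f (Posz i)))//.
rewrite nneseries_recl//; congr (_ + _).
rewrite -(nneseries_addn (f := fun i => f (Posz i))) //.
by apply: eq_eseriesr => i _; rewrite addn1.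
Qed.

End Esum.

(** * Balance and block events for random words *)

Section RandomWords.
Variables (R : realType) (T : choiceType) (p : T -> R).
Hypothesis p_ge0 : forall z, 0 <= p z.
Hypothesis p_sum1 : (\esum_(z in [set: T]) (p z)%:E = 1)%E.
Local Open Scope ereal_scope.

Lemma fin_num_mass (S : pred T) :
  \esum_(z in [set: T]) (p z * (S z)%:R)%:E \is a fin_num.
Proof.
rewrite ge0_fin_numE; last by apply: esum_ge0 => z _; rewrite lee_fin mulr_ge0.
rewrite (@le_lt_trans _ _ 1) ?ltry// -p_sum1; apply: le_esum => z _.
by rewrite lee_fin; case: (S z); rewrite ?mulr1 ?mulr0.
Qed.

Lemma mass1 (a : T) : \esum_(z in [set: T]) (p z * (z == a)%:R)%:E = (p a)%:E.
Proof.
rewrite (esum_single (x := a)) ?eqxx ?mulr1// ?lee_fin//.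
by move=> z /negPf->; rewrite mulr0.
Qed.

Lemma prob_le1 (a : T) : (p a <= 1)%R.
Proof.
rewrite -lee_fin -p_sum1 -mass1; apply: le_esum => z _.
by rewrite lee_fin; case: eqP; rewrite ?mulr1 ?mulr0.
Qed.

Section Types.
Variables (a : T) (D U : pred T).

(** The type keeps the three bits of a letter that the events below can test, which brings them to a
    finite alphabet. *)
Let type z := (z == a, D z, U z).

Let q f := fine (\esum_(z in [set: T]) (p z * (type z == f)%:R)%:E).

Let qE f : \esum_(z in [set: T]) (p z * (type z == f)%:R)%:E = (q f)%:E.
Proof. by rewrite fineK ?fin_num_mass. Qed.

Let q_sum1 : (\sum_f q f = 1)%R.
Proof.
apply: EFin_inj; rewrite -(esum_type_pred xpredT p_ge0 qE) -[RHS]p_sum1.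
by apply: eq_esum => z _; rewrite mulr1.
Qed.

Lemma esum_words_balanced n (x y : R) :
  \esum_(z in [set: T]) (p z * (D z)%:R)%:E = x%:E ->
  \esum_(z in [set: T]) (p z * (U z)%:R)%:E = y%:E ->
  \sum_(k < n) \esum_(w in [set: {ffun 'I_n -> T}])
    ((\prod_(l < n) p (w l)) * ((w k == a) &&
       (#|[pred l : 'I_n | (k < l)%N && D (w l)]| ==
        #|[pred l : 'I_n | (l < k)%N && U (w l)]|))%:R)%:E =
  (p a * \sum_(j < n) (1 - x - y) ^+ j)%:E.
Proof.
move=> xE yE.
pose G (f : bool * bool * bool) := f.1.1.
pose D' (f : bool * bool * bool) := f.1.2.
pose U' (f : bool * bool * bool) := f.2.
have -> : p a = (\sum_(f | G f) q f)%R.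
  by apply: EFin_inj; rewrite -(esum_type_pred G p_ge0 qE) mass1.
have -> : x = (\sum_(f | D' f) q f)%R.
  by apply: EFin_inj; rewrite -(esum_type_pred D' p_ge0 qE) -xE.
have -> : y = (\sum_(f | U' f) q f)%R.
  by apply: EFin_inj; rewrite -(esum_type_pred U' p_ge0 qE) -yE.
rewrite -sum_balanced_ffun// -sumEFin; apply: eq_bigr => k _.
pose Phi (c : {ffun 'I_n -> bool * bool * bool}) : R := (G (c k) &&
  (#|[pred l : 'I_n | (k < l)%N && D' (c l)]| ==
   #|[pred l : 'I_n | (l < k)%N && U' (c l)]|))%:R.
transitivity ((\sum_(c : {ffun 'I_n -> bool * bool * bool})
    (\prod_(l < n) q (c l)) * Phi c)%R%:E); last first.
  congr EFin; rewrite [RHS]big_mkcond; apply: eq_bigr => c _.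
  by rewrite /Phi; case: ifP; rewrite ?mulr1 ?mulr0.
rewrite -(esum_ffun_types (Phi := Phi) p_ge0 _ qE)//; apply: eq_esum => w _.
rewrite /Phi ffunE /G /=; congr ((_ * _%:R)%R%:E).
by congr (nat_of_bool (_ && (_ == _))); apply: eq_card => l; rewrite !inE ffunE.
Qed.

Lemma esum_words_block n : (0 < n)%N -> ~~ D a ->
  \sum_(k < n) \esum_(w in [set: {ffun 'I_n -> T}])
    ((\prod_(l < n) p (w l)) * (if (w k == a) &&
       (#|[pred l | D (w l)]| <= k < #|[pred l | D (w l)]| + #|[pred l | w l == a]|)%N
       then (#|[pred l | w l == a]|)%:R^-1 else 0))%:E =
  (p a)%:E.
Proof.
move=> n_gt0 Da.
pose G (f : bool * bool * bool) := f.1.1.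
(* [L] and [G] must be disjoint on every type, even on those that no letter has; hence the second
   conjunct, harmless because [D a] is false. *)
pose L (f : bool * bool * bool) := f.1.2 && ~~ f.1.1.
have -> : p a = (\sum_(f | G f) q f)%R.
  by apply: EFin_inj; rewrite -(esum_type_pred G p_ge0 qE) mass1.
rewrite -(@sum_block_ffun _ _ q n G L)//; last by move=> f /andP[].
rewrite -sumEFin; apply: eq_bigr => k _.
pose Phi (c : {ffun 'I_n -> bool * bool * bool}) : R := (if G (c k) &&
  (#|[pred l | L (c l)]| <= k < #|[pred l | L (c l)]| + #|[pred l | G (c l)]|)%N
  then (#|[pred l | G (c l)]|)%:R^-1 else 0)%R.
transitivity ((\sum_(c : {ffun 'I_n -> bool * bool * bool})
    (\prod_(l < n) q (c l)) * Phi c)%R%:E); last first.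
  congr EFin; rewrite [RHS]big_mkcond; apply: eq_bigr => c _.
  by rewrite /Phi; case: (G _) => //=; rewrite mulr0.
rewrite -(esum_ffun_types (Phi := Phi) p_ge0 _ qE)//; last first.
  by move=> c; rewrite /Phi; case: ifP.
apply: eq_esum => w _; congr ((_ * _)%R%:E).
have EL : #|[pred l | L ([ffun l => type (w l)] l)]| = #|[pred l | D (w l)]|.
  apply: eq_card => l; rewrite !inE ffunE /L /=; case: eqP => [->|]; rewrite ?andbT//.
  by rewrite (negPf Da).
have EG : #|[pred l | G ([ffun l => type (w l)] l)]| = #|[pred l | w l == a]|.
  by apply: eq_card => l; rewrite !inE ffunE.
by rewrite /Phi EL EG ffunE.
Qed.

End Types.
End RandomWords.

(** * Expected number of fixed points *)

Local Open Scope ereal_scope.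

Section Series.
Variable R : realType.

Lemma eseries_EFin (u : nat -> R) : cvgn (series u) ->
  \sum_(0 <= i <oo) (u i)%:E = (limn (series u))%:E.
Proof.
move=> cu; rewrite -EFin_lim//; apply: congr_lim.
by apply/funext => n; rewrite /= /series/= sumEFin.
Qed.

(** Serves to exchange the finite sum over exponents with the series over letters when terms may be
    negative. *)
Lemma cvg_series_sum (I : Type) (r : seq I) (f : I -> nat -> R) :
  (forall j, cvgn (series (f j))) ->
  cvgn (series (fun i => (\sum_(j <- r) f j i)%R)) /\
  limn (series (fun i => (\sum_(j <- r) f j i)%R)) = (\sum_(j <- r) limn (series (f j)))%R.
Proof.
move=> cf; elim: r => [|j r [IHc IHl]].
  have -> : series (fun i => (\sum_(j <- [::]) f j i)%R) = cst 0%R :> (nat -> R).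
    by apply/funext => n; rewrite /series/= big1// => i _; rewrite big_nil.
  by rewrite big_nil; split; [exact: is_cvg_cst|exact: lim_cst].
have -> : (fun i => (\sum_(j0 <- j :: r) f j0 i)%R) =
   (f j + (fun i => (\sum_(j0 <- r) f j0 i)%R))%R.
  by apply/funext => i; rewrite big_cons.
by split; [exact: is_cvg_seriesD|rewrite lim_seriesD// IHl big_cons].
Qed.

Lemma cvg_series_ge0 (u : nat -> R) (M : R) : (forall i, (0 <= u i)%R) ->
  \sum_(0 <= i <oo) (u i)%:E <= M%:E -> cvgn (series u).
Proof.
move=> u0 uM.
apply: (@summable_cvg R xpredT (EFin \o u)) => [i _|]; first by rewrite lee_fin.
rewrite /summable; apply: le_lt_trans (ltry M); apply: le_trans uM.
rewrite (nneseries_esum (P := xpredT)) => [|i _]; last by rewrite lee_fin.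
by apply: le_esum => i _; rewrite /= ger0_norm.
Qed.

Lemma cvg_series_exp (u : nat -> R) j : (forall i, (0 <= u i <= 1)%R) ->
  cvgn (series u) -> cvgn (series (fun i => u i ^+ j.+1)%R).
Proof.
move=> u01; apply: series_le_cvg => i; have /andP[u0 u1] := u01 i => //.
  exact: exprn_ge0.
by rewrite exprS ler_piMr// exprn_ile1.
Qed.

End Series.

(** [f (X t)] is a finite combination of indicators of the fibres of [X]. *)
Lemma expectation_finite (R : realType) (d : measure_display) (T : measurableType d)
    (P : probability T R) (F : finType) (X : T -> F) (f : F -> R) :
  (forall s, (0 <= f s)%R) ->
  (forall s, measurable [set t | X t = s]%classic) ->
  'E_P[fun t => f (X t)] = \sum_s (f s)%:E * P [set t | X t = s]%classic.
Proof.
move=> f0 mX; rewrite unlock.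
transitivity (\int[P]_t (\sum_(s <- index_enum F) ((f s)%:E * (\1_[set t | X t = s] t)%:E))).
  apply: eq_integral => t _; rewrite (bigD1 (X t))//= indicE mem_set// mule1 big1 ?adde0// => s sX.
  by rewrite indicE memNset ?mule0//=; apply/eqP; rewrite eq_sym.
rewrite ge0_integral_sum//; last 2 first.
- by move=> s; apply: measurable_funeM; apply/measurable_EFinP; exact: measurable_indic.
- by move=> s t _; rewrite mule_ge0 ?lee_fin.
apply: eq_bigr => s _; rewrite ge0_integralZl_EFin//; last first.
  by apply/measurable_EFinP; exact: measurable_indic.
by rewrite integral_indic// setIT.
Qed.

(** * Contribution of each letter to the expectation *)

Section Letters.
Variables (R : realType) (alpha beta : nat -> R) (gamma : R).
Hypothesis alpha_ge0 : forall i : nat, (0 <= alpha i)%R.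
Hypothesis beta_ge0 : forall i : nat, (0 <= beta i)%R.
Hypothesis gamma_ge0 : (0 <= gamma)%R.
Hypothesis sum_eq1 : gamma%:E + \sum_(0 <= i <oo) (alpha i)%:E
                 + \sum_(0 <= i <oo) (beta i)%:E = 1.

Let p := letter_prob alpha beta gamma.

Lemma letter_prob_ge0 z : (0 <= p z)%R.
Proof. by case: z => [[|i]|i]; rewrite /p /=. Qed.

Lemma letter_prob_sum1 : \esum_(z in [set: int]) (p z)%:E = 1.
Proof. by rewrite esum_int => [|z]; rewrite ?lee_fin ?letter_prob_ge0// -[RHS]sum_eq1. Qed.

Let mass (S : pred int) : R := fine (\esum_(z in [set: int]) (p z * (S z)%:R)%:E).

Let massE (S : pred int) : \esum_(z in [set: int]) (p z * (S z)%:R)%:E = (mass S)%:E.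
Proof. by rewrite fineK// fin_num_mass//; [exact: letter_prob_ge0|exact: letter_prob_sum1]. Qed.

(** A relation between indicators passes to masses; [xpred0] pads shorter relations to this
    shape. *)
Let massD (A B C D : pred int) : (forall z, A z + B z = C z + D z)%N ->
  (mass A + mass B = mass C + mass D)%R.
Proof.
move=> ABCD; apply: EFin_inj; rewrite !EFinD -!massE -!esumD; try by
  move=> z _; rewrite lee_fin mulr_ge0// letter_prob_ge0.
by apply: eq_esum => z _; rewrite -!EFinD -!mulrDr -!natrD ABCD.
Qed.

Let mass_eq a : mass (pred1 a) = p a.
Proof. by apply: EFin_inj; rewrite -massE mass1//; exact: letter_prob_ge0. Qed.

Let mass_T : mass xpredT = 1%R.
Proof.
by apply: EFin_inj; rewrite -massE -letter_prob_sum1; apply: eq_esum => z _; rewrite mulr1.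
Qed.

Let mass_0 : mass xpred0 = 0%R.
Proof. by apply: EFin_inj; rewrite -massE esum1// => z _; rewrite mulr0. Qed.

Variable n : nat.

(** The expected number of fixed positions that carry the letter [z]. *)
Definition fix_at (z : int) : \bar R := \sum_(k < n) \esum_(w in [set: {ffun 'I_n -> int}])
  ((\prod_(l < n) p (w l)) * (fix_prob R w k * (w k == z)%:R))%:E.

Lemma fix_at_pos z : (0 < z)%R -> fix_at z = (\sum_(1 <= j < n.+1) p z ^+ j)%:E.
Proof.
move=> z0; pose D : pred int := fun l => (l < z)%R; pose U : pred int := fun l => (z < l)%R.
transitivity (p z * \sum_(j < n) (1 - mass D - mass U) ^+ j)%:E.
  rewrite -(esum_words_balanced letter_prob_ge0 letter_prob_sum1 z n (massE _) (massE _)).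
  apply: eq_bigr => k _; apply: eq_esum => w _; congr ((_ * _)%R%:E).
  by case: eqP => [wk|_]; rewrite /= ?mulr0// fix_prob_pos ?wk ?mulr1.
(* [D], [U] and the letter [z] partition the alphabet. *)
have -> : (1 - mass D - mass U = p z)%R.
  have H1 : (mass xpredT + mass xpred0 = mass (fun l => l <= z)%R + mass U)%R.
    by apply: massD => l; rewrite /U; case: ltgtP.
  have H2 : (mass (fun l => l <= z)%R + mass xpred0 = mass D + mass (pred1 z))%R.
    by apply: massD => l; rewrite /D /=; case: ltgtP.
  move: H1 H2; rewrite mass_eq mass_T mass_0 => H1 H2; lra.
congr EFin; rewrite big_add1/= big_mkord mulr_sumr.
by apply: eq_bigr => j _; rewrite exprS.
Qed.

Lemma fix_at_neg z : (z < 0)%R ->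
  fix_at z = (\sum_(1 <= j < n.+1) (-1) ^+ j.+1 * p z ^+ j)%:E.
Proof.
move=> z0; pose D : pred int := fun l => (l <= z)%R; pose U : pred int := fun l => (z <= l)%R.
transitivity (p z * \sum_(j < n) (1 - mass D - mass U) ^+ j)%:E.
  rewrite -(esum_words_balanced letter_prob_ge0 letter_prob_sum1 z n (massE _) (massE _)).
  apply: eq_bigr => k _; apply: eq_esum => w _; congr ((_ * _)%R%:E).
  by case: eqP => [wk|_]; rewrite /= ?mulr0// fix_prob_neg ?wk ?mulr1.
(* [D] and [U] cover the alphabet and overlap exactly in [z], whence the alternating sign. *)
have -> : (1 - mass D - mass U = - p z)%R.
  have : (mass D + mass U = mass xpredT + mass (pred1 z))%R.
    by apply: massD => l; rewrite /D /U /=; case: ltgtP.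
  rewrite mass_eq mass_T => H1; lra.
congr EFin; rewrite big_add1/= big_mkord mulr_sumr.
apply: eq_bigr => j _; rewrite -[(- p z)%R]mulN1r exprMn !exprS; ring.
Qed.

Lemma fix_at_zero : (0 < n)%N -> fix_at 0%R = gamma%:E.
Proof.
move=> n0; rewrite -[gamma]/(p 0%R).
rewrite -(esum_words_block letter_prob_ge0 letter_prob_sum1 (a := 0%R)
  (D := fun l => (l < 0)%R) xpred0 n0)//.
apply: eq_bigr => k _; apply: eq_esum => w _; congr ((_ * _)%R%:E).
case: eqP => [wk|_]; rewrite /= ?mulr0// mulr1.
exact: fix_prob_zero.
Qed.

(** All terms are non-negative, so sums may be exchanged freely: first condition on the word, then
    sort the fixed positions by their letter. *)
Lemma expectation_fix (d : measure_display) (T : measurableType d)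
    (P : probability T R) (sigma : T -> 'S_n) :
  shuffle_distributed alpha beta gamma P sigma ->
  'E_P[fun t => (fixed_points (sigma t))%:R%R] = \esum_(z in [set: int]) fix_at z.
Proof.
move=> sh.
have pr0 (w : {ffun 'I_n -> int}) : (0 <= \prod_(l < n) p (w l))%R.
  by apply: prodr_ge0 => l _; exact: letter_prob_ge0.
have fp0 w (s : 'S_n) : (0 <= fill_prob R w s)%R by rewrite /fill_prob; case: ifP.
have fx0 (w : {ffun 'I_n -> int}) k : (0 <= fix_prob R w k)%R by apply: sumr_ge0 => s _; exact: fp0.
rewrite (expectation_finite _ _ (f := fun s : 'S_n => (fixed_points s)%:R%R))
  => [|//|s]; last first.
  by have [] := sh s.
transitivity (\sum_(k < n) \esum_(w in [set: {ffun 'I_n -> int}])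
   ((\prod_(l < n) p (w l)) * fix_prob R w k)%:E).
  transitivity (\esum_(w in [set: {ffun 'I_n -> int}])
     \sum_s ((fixed_points s)%:R%:E * ((\prod_(l < n) p (w l)) * fill_prob R w s)%:E)).
    rewrite esum_sum => [|w s _ _]; last first.
      by rewrite -EFinM lee_fin mulr_ge0// mulr_ge0.
    apply: eq_bigr => s _; have [_ ->] := sh s.
    by rewrite esumZl// => w; rewrite lee_fin mulr_ge0.
  rewrite -esum_sum => [|w k _ _]; last by rewrite lee_fin mulr_ge0.
  apply: eq_esum => w _; rewrite !sumEFin; congr EFin.
  rewrite -mulr_sumr /fix_prob (exchange_big_dep xpredT)//= mulr_sumr.
  apply: eq_bigr => s _; rewrite sumr_const mulrCA; congr (_ * _)%R.
  by rewrite /fixed_points mulr_natl.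
rewrite /fix_at esum_sum => [|z k _ _]; last first.
  by apply: esum_ge0 => w _; rewrite lee_fin !mulr_ge0.
apply: eq_bigr => k _; rewrite exchange_esum => [|z w]; last first.
  by rewrite lee_fin !mulr_ge0.
apply: eq_esum => w _; rewrite (esum_single (x := w k)) ?eqxx ?mulr1//.
  by rewrite lee_fin mulr_ge0.
by move=> z; rewrite eq_sym => /negPf->; rewrite !mulr0.
Qed.

End Letters.

Theorem mainTheorem9 (R : realType) (alpha beta : nat -> R) (gamma : R)
    (alpha_ge0 : forall i : nat, (0 <= alpha i)%R)
    (beta_ge0 : forall i : nat, (0 <= beta i)%R)
    (gamma_ge0 : (0 <= gamma)%R)
    (sum_eq1 : gamma%:E + \sum_(0 <= i <oo) (alpha i)%:E
                 + \sum_(0 <= i <oo) (beta i)%:E = 1)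
    (n : nat) (n_ge1 : (1 <= n)%N)
    (d : measure_display) (T : measurableType d) (P : probability T R)
    (sigma : T -> 'S_n)
    (sigma_shuffle : shuffle_distributed alpha beta gamma P sigma) :
  'E_P[fun t => (fixed_points (sigma t))%:R%R] =
    gamma%:E + \sum_(1 <= j < n.+1)
      \sum_(0 <= i <oo) (alpha i ^+ j + (-1) ^+ j.+1 * beta i ^+ j)%:E
  /\
  gamma%:E + \sum_(1 <= j < n.+1)
      \sum_(0 <= i <oo) (alpha i ^+ j + (-1) ^+ j.+1 * beta i ^+ j)%:E =
    \sum_(1 <= j < n.+1) ext_power_sum alpha beta gamma j.
Proof.
have sa0 : 0 <= \sum_(0 <= i <oo) (alpha i)%:E.
  by apply: nneseries_ge0 => i _ _; rewrite lee_fin.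
have sb0 : 0 <= \sum_(0 <= i <oo) (beta i)%:E.
  by apply: nneseries_ge0 => i _ _; rewrite lee_fin.
have ca : cvgn (series alpha).
  apply: (@cvg_series_ge0 _ _ 1)%R => //; rewrite -sum_eq1 addeAC.
  by rewrite leeDr// adde_ge0 ?lee_fin.
have cb : cvgn (series beta).
  apply: (@cvg_series_ge0 _ _ 1)%R => //; rewrite -sum_eq1.
  by rewrite leeDr// adde_ge0 ?lee_fin.
have p_ge0 := letter_prob_ge0 alpha_ge0 beta_ge0 gamma_ge0.
have p_sum1 := letter_prob_sum1 alpha_ge0 beta_ge0 gamma_ge0 sum_eq1.
have caX j : cvgn (series (fun i => alpha i ^+ j.+1)%R).
  apply: cvg_series_exp => // i; rewrite alpha_ge0/=.
  exact: (prob_le1 p_ge0 p_sum1 (Posz i.+1)).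
have cbX j : cvgn (series (fun i => beta i ^+ j.+1)%R).
  apply: cvg_series_exp => // i; rewrite beta_ge0/=.
  exact: (prob_le1 p_ge0 p_sum1 (Negz i)).
(* The signed terms may be negative, so the rearrangements go through convergent real series. The
   exponent is [j.+1], hence the sign [(-1) ^+ j.+2]. *)
pose sgn_beta j i : R := ((-1) ^+ j.+2 * beta i ^+ j.+1)%R.
have csb j : cvgn (series (sgn_beta j)) by exact: is_cvg_seriesZ.
have lsb j : limn (series (sgn_beta j)) =
    ((-1) ^+ j.+2 * limn (series (fun i => beta i ^+ j.+1)))%R.
  exact: lim_seriesZ.
have termE j : \sum_(0 <= i <oo) (alpha i ^+ j.+1 + (-1) ^+ j.+2 * beta i ^+ j.+1)%:E =
    (limn (series (fun i => alpha i ^+ j.+1)) + limn (series (sgn_beta j)))%R%:E.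
  rewrite -(lim_seriesD (caX j) (csb j)) -(eseries_EFin (is_cvg_seriesD (caX j) (csb j))).
  exact: eq_eseriesr.
split.
  rewrite (expectation_fix alpha_ge0 beta_ge0 gamma_ge0 sigma_shuffle) esum_int; last first.
    move=> z; apply: sume_ge0 => k _; apply: esum_ge0 => w _.
    rewrite lee_fin mulr_ge0 ?prodr_ge0// mulr_ge0//.
    by apply: sumr_ge0 => s _; rewrite /fill_prob; case: ifP.
  rewrite (fix_at_zero alpha_ge0 beta_ge0 gamma_ge0 sum_eq1)// -addeA; congr (_ + _).
  rewrite big_add1/=; under [RHS]eq_bigr do rewrite termE.
  rewrite sumEFin big_split/= EFinD.
  (* Moving the sum over exponents inside the series groups the terms by letter, as in [fix_at_pos]
     and [fix_at_neg]. *)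
  have [ca1 <-] := cvg_series_sum (index_iota 0 n) caX.
  have [cb1 <-] := cvg_series_sum (index_iota 0 n) csb.
  rewrite -!eseries_EFin//; congr (_ + _); apply: eq_eseriesr => i _.
    by rewrite (fix_at_pos alpha_ge0 beta_ge0 gamma_ge0 sum_eq1)// big_add1.
  by rewrite (fix_at_neg alpha_ge0 beta_ge0 gamma_ge0 sum_eq1)// big_add1.
(* Only the first power sum contains [gamma], so it is paired with the term j = 1, whose sign is
   (-1)^2 = 1; from j = 2 on the sums agree term by term. *)
rewrite big_ltn// [RHS]big_ltn// addeA; congr (_ + _).
  by rewrite termE lsb sqrrN expr1n mul1r EFinD addeA -!eseries_EFin// /ext_power_sum eqxx.
rewrite [LHS]big_nat [RHS]big_nat; apply: eq_bigr => -[//|j] /andP[j1 _].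
rewrite termE lsb /ext_power_sum gtn_eqF// EFinD EFinM.
by rewrite !eseries_EFin.
Qed.
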